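(* Let $N$ be an integer such that $N \ge 18$. Let $\mathsf{F} = \mathsf{F}_q$ be a finite field with size $q \ge 16N+9$. Let $m$ and $n$ be integers such that $n \ge m \ge 0$ and $n \ge 1$. Let $$\sigma = \left(1-\frac1q\right)\left(6+\frac3N\right), \qquad \tau = 1, \qquad \upsilon = \left\lceil (2N+1)\ln(2N+1) + \frac{167}{5}(2N+1)\right\rceil.$$ There exists a random procedure (depending on $N$, $q$, $m$, $n$ only, and not on the matrix $A$ below) for generating $n-m$ row vectors in $\mathsf{F}^{1\times n}$ such that the following hold. (1) The expected total number of nonzero entries in the generated rows is at most $\sigma n\ln n+\tau n$ if $n-m\ge\upsilon$, and at most $\frac{q-1}{q}(n-m)n\le\frac{q-1}{q}\upsilon n$ otherwise. (2) For every matrix $A\in\mathsf{F}^{m\times n}$ of rank $m$, let $B\in\mathsf{F}^{n\times n}$ be the matrix obtained from $A$ by appending the generated rows. If $q\le n^2$ then $B$ is nonsingular with probability at least $\frac89$. If $q>n^2$ then $B$ is nonsingular with probability at least $\frac89-\frac{8}{9n}$.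
   Context: A ''random procedure'' is a probability distribution on $(n-m)$-tuples of vectors in $\mathsf{F}^{1\times n}$. *)

(* Defs.v *)
From mathcomp Require Import all_boot all_order all_algebra.
From mathcomp Require Import reals exp.

Set Implicit Arguments.
Unset Strict Implicit.
Unset Printing Implicit Defensive.

Import Order.TTheory GRing.Theory Num.Theory.
Local Open Scope ring_scope.

(* Probability mass functions; every subset of the finite type T is an event. *)
Record distr (R : realType) (T : finType) := Distr {
  pmf :> T -> R;
  pmf_ge0 : forall x, 0 <= pmf x;
  pmf_sum1 : \sum_x pmf x = 1 }.

Definition prob (R : realType) (T : finType) (P : distr R T) (E : pred T) : R :=
  \sum_(x | E x) P x.

Definition expect (R : realType) (T : finType) (P : distr R T) (X : T -> R) : R :=
  \sum_x P x * X x.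

Definition nonzero_entries (F : fieldType) (k n : nat)
    (t : k.-tuple 'rV[F]_n) : nat :=
  #|[set ij : 'I_k * 'I_n | tnth t ij.1 ord0 ij.2 != 0]|.

Definition append_rows (F : fieldType) (m n : nat) (hmn : (m <= n)%N)
    (A : 'M[F]_(m, n)) (t : (n - m).-tuple 'rV[F]_n) : 'M[F]_n :=
  castmx (subnKC hmn, erefl n) (col_mx A (\matrix_(i < n - m) tnth t i)).

Definition sigma (R : realType) (N q : nat) : R :=
  (1 - 1 / q%:R) * (6 + 3 / N%:R).

Definition tau (R : realType) : R := 1.

Definition upsilon (R : realType) (N : nat) : int :=
  Num.ceil ((2 * N%:R + 1) * ln (2 * N%:R + 1)
            + 167 / 5 * (2 * N%:R + 1) : R).

(* Main.v *)
(* All k = n - m rows have i.i.d. entries, 0 with probability 1 - rho and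
   uniform in F with probability rho. Here rho = 1 when n - m is below upsilon
   or at most 6 ln n, and rho = 6 ln n / k otherwise, so that the expected number
   of nonzero entries is (1 - 1/q) rho k n. A row is orthogonal to a vector of
   weight w with probability b_w = 1/q + (1 - 1/q) (1 - rho)^w. Parametrizing
   ker A as K F^k, where k of the rows of K form the identity, B is singular iff
   R K u = 0 for some u <> 0, where R is the matrix of generated rows, and K u
   has at least the weight of u.
   If q <= n^2, the expected number of lines of such u is at most
   sum_w C(k,w) (q-1)^(w-1) b_w^k, which is at most 1/9.
   If q > n^2 this first moment is too large. Instead, for u of support I with
   |I| = w, the columns of R K indexed by I have rank at most w - 1, so some w - 1
   rows C of R K already force every vector of support I that they kill to be in
   the kernel of R K. Guessing such a vector from the rows in C, the other rows
   must be orthogonal to it, and the union bound over (I, C) is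
   sum_w C(k,w) C(k,w-1) b_w^(k-w+1), again at most 1/9. *)
Require Import Defs.
From mathcomp Require Import all_boot all_order all_algebra.
From mathcomp Require Import reals exp.
From mathcomp Require Import sequences zify ring lra.

Set Implicit Arguments.
Unset Strict Implicit.
Unset Printing Implicit Defensive.

Import Order.TTheory GRing.Theory Num.Theory.
Local Open Scope ring_scope.

(** * Factorisation over independent rows and entries *)

Lemma sum_tuple_prod (R : comPzSemiRingType) (T : finType) (k : nat)
    (Q : 'I_k -> pred T) (f : 'I_k -> T -> R) :
  \sum_(t : k.-tuple T | [forall i, Q i (tnth t i)]) \prod_i f i (tnth t i)
  = \prod_i \sum_(x | Q i x) f i x.
Proof.
rewrite bigA_distr_big_dep (reindex (@finfun_of_tuple T k)) /=; last first.
  by exists (@tuple_of_finfun T k) => ? _;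
    rewrite ?tuple_of_finfunK ?finfun_of_tupleK.
apply: eq_big => [t|t _]; last by apply: eq_bigr => i _; rewrite ffunE.
apply/forallP/familyP => h i; first by rewrite ffunE; exact: h.
by have := h i; rewrite ffunE.
Qed.

Lemma sum_rV_prod (R : comPzSemiRingType) (F : finType) (n : nat)
    (f : 'I_n -> F -> R) :
  \sum_(r : 'rV[F]_n) \prod_j f j (r ord0 j) = \prod_j \sum_x f j x.
Proof.
rewrite bigA_distr_bigA (reindex (fun g : {ffun 'I_n -> F} => \row_j g j)) /=.
  by apply: eq_bigr => g _; apply: eq_bigr => j _; rewrite mxE.
exists (fun r : 'rV[F]_n => [ffun j => r ord0 j]) => r _.
  by apply/ffunP => j; rewrite ffunE mxE.
by apply/rowP => j; rewrite mxE ffunE.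
Qed.

(** * The law of sparse random rows *)

Section SparseRows.
Variables (R : realFieldType) (F : finFieldType).
Implicit Types (rho : R) (n k : nat).

Definition entry_pmf rho (x : F) : R :=
  (1 - rho) * (x == 0)%:R + rho / #|F|%:R.

Definition row_pmf rho n (r : 'rV[F]_n) : R := \prod_j entry_pmf rho (r ord0 j).

Definition rows_pmf rho n k (t : k.-tuple 'rV[F]_n) : R :=
  \prod_i row_pmf rho (tnth t i).

Definition weight n (v : 'cV[F]_n) : nat := #|[set j | v j ord0 != 0]|.

(** This is [b_w] of the overview, with [q = #|F|]. *)
Definition zero_prob rho w : R :=
  #|F|%:R^-1 + (1 - #|F|%:R^-1) * (1 - rho) ^+ w.

Lemma card_neq0 : #|F|%:R != 0 :> R.
Proof. by rewrite pnatr_eq0 -lt0n; apply/card_gt0P; exists 0. Qed.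

Lemma sum_delta (x : F) (g : F -> R) : \sum_y (y == x)%:R * g y = g x.
Proof.
rewrite (bigD1 x) //= eqxx mul1r big1 ?addr0 // => y /negPf ->.
by rewrite mul0r.
Qed.

Lemma sum_constr (a : R) : \sum_(x : F) a = #|F|%:R * a.
Proof. by rewrite sumr_const mulr_natl. Qed.

Lemma entry_pmf_ge0 rho (x : F) : 0 <= rho <= 1 -> 0 <= entry_pmf rho x.
Proof.
move=> /andP[r0 r1]; apply: addr_ge0; last by rewrite divr_ge0.
by rewrite mulr_ge0 // subr_ge0.
Qed.

Lemma sum_entry_pmf_mul rho (g : F -> R) :
  \sum_x entry_pmf rho x * g x
  = (1 - rho) * g 0 + rho / #|F|%:R * \sum_x g x.
Proof.
rewrite /entry_pmf.
under eq_bigr do rewrite mulrDl -(mulrA (1 - rho)).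
rewrite big_split /= -mulr_sumr sum_delta.
by rewrite mulr_sumr.
Qed.

Lemma sum_entry_pmf rho : \sum_(x : F) entry_pmf rho x = 1.
Proof.
have := sum_entry_pmf_mul rho (fun=> 1).
rewrite mulr1 sumr_const mulfVK ?card_neq0 // subrK => <-.
by apply: eq_bigr => x _; rewrite mulr1.
Qed.

Lemma sum_entry_pmf_neq0 rho :
  \sum_(x : F) entry_pmf rho x * (x != 0)%:R = rho * (1 - #|F|%:R^-1).
Proof.
rewrite sum_entry_pmf_mul eqxx mulr0 add0r.
have -> : \sum_(x : F) (x != 0)%:R = #|F|%:R - 1 :> R.
  transitivity (\sum_(x : F) (1 - (x == 0)%:R) : R).
    by apply: eq_bigr => x _; case: (x == 0); rewrite ?subrr ?subr0.
  rewrite big_split /= sumr_const sumrN; congr (_ - _).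
  rewrite -[RHS](sum_delta 0 (fun=> 1)).
  by apply: eq_bigr => x _; rewrite mulr1.
by field; exact: card_neq0.
Qed.

Lemma row_pmf_ge0 rho n (r : 'rV[F]_n) : 0 <= rho <= 1 -> 0 <= row_pmf rho r.
Proof. by move=> h; apply: prodr_ge0 => j _; exact: entry_pmf_ge0. Qed.

Lemma sum_row_pmf rho n : \sum_(r : 'rV[F]_n) row_pmf rho r = 1.
Proof.
rewrite (sum_rV_prod (fun=> entry_pmf rho)).
by rewrite big1 // => j _; exact: sum_entry_pmf.
Qed.

Lemma rows_pmf_ge0 rho n k (t : k.-tuple 'rV[F]_n) :
  0 <= rho <= 1 -> 0 <= rows_pmf rho t.
Proof. by move=> h; apply: prodr_ge0 => j _; exact: row_pmf_ge0. Qed.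

Lemma sum_rows_pmf_forall rho n k (Q : 'I_k -> pred 'rV[F]_n) :
  \sum_(t : k.-tuple 'rV[F]_n | [forall i, Q i (tnth t i)]) rows_pmf rho t
  = \prod_i \sum_(r | Q i r) row_pmf rho r.
Proof. exact: sum_tuple_prod. Qed.

Lemma sum_rows_pmf rho n k : \sum_(t : k.-tuple 'rV[F]_n) rows_pmf rho t = 1.
Proof.
rewrite -(eq_bigl _ _ (fun t => (introT forallP (fun i => erefl true)
  : [forall i : 'I_k, xpredT (tnth t i)]))).
rewrite (@sum_rows_pmf_forall rho n k (fun=> xpredT)).
by rewrite big1 // => i _; exact: sum_row_pmf.
Qed.

(* Only the coordinates with [v_j != 0] matter; adding one of them to the sum
   replaces the law [P] of the sum by [(1 - rho) P + rho / q]. *)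
Lemma sum_row_pmf_dot rho n (v : 'cV[F]_n) (c : F) :
  \sum_(r : 'rV[F]_n | (r *m v) ord0 ord0 == c) row_pmf rho r
  = #|F|%:R^-1 + (1 - rho) ^+ weight v * ((c == 0)%:R - #|F|%:R^-1).
Proof.
elim: n v c => [|n IHn] v c.
  have w0 : weight v = 0%N by apply: eq_card0 => -[].
  rewrite w0 expr0 mul1r addrC subrK.
  have E (r : 'rV[F]_0) : ((r *m v) ord0 ord0 == c) = (c == 0).
    by rewrite mxE big_ord0 eq_sym.
  under eq_bigl do rewrite E.
  case: (c == 0); last by rewrite big_pred0.
  exact: sum_row_pmf.
(* Retyping [v] over [1 + n] lets block operations split off the first coordinate. *)
pose v1 : 'cV[F]_(1 + n) := v.
rewrite (reindex (fun p : F * 'rV[F]_n =>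
    (row_mx p.1%:M p.2 : 'rV[F]_(1 + n)))) /=; last first.
  exists (fun r : 'rV[F]_(1 + n) => (lsubmx r ord0 ord0, rsubmx r)).
    by move=> [x r] _; rewrite row_mxKl row_mxKr mxE eqxx mulr1n.
  by move=> r _; rewrite -mx11_scalar hsubmxK.
have dotE (p : F * 'rV[F]_n) :
    ((row_mx p.1%:M p.2 : 'rV[F]_(1 + n)) *m v) ord0 ord0
    = p.1 * v1 ord0 ord0 + (p.2 *m dsubmx v1) ord0 ord0.
  rewrite -[v in LHS](vsubmxK v1) mul_row_col mxE; congr (_ + _).
  by rewrite mul_scalar_mx !mxE; congr (_ * v _ _); apply: val_inj.
have pmfE (p : F * 'rV[F]_n) :
    row_pmf rho (row_mx p.1%:M p.2 : 'rV[F]_(1 + n))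
    = entry_pmf rho p.1 * row_pmf rho p.2.
  rewrite /row_pmf big_ord_recl; congr (_ * _).
    have -> : ord0 = lshift n ord0 :> 'I_(1 + n) by apply: val_inj.
    by rewrite row_mxEl mxE eqxx.
  apply: eq_bigr => j _.
  have -> : lift ord0 j = rshift 1 j by apply: val_inj.
  by rewrite row_mxEr.
under eq_bigl do rewrite dotE.
under eq_bigr do rewrite pmfE.
rewrite big_mkcond -(pair_bigA _ (fun x r =>
  if x * v1 ord0 ord0 + (r *m dsubmx v1) ord0 ord0 == c
  then entry_pmf rho x * row_pmf rho r else 0)) /=.
(* Condition on the first entry [x]: the remaining coordinates must sum to [c - x * v_0], which is
   the induction hypothesis. *)
transitivity (\sum_x entry_pmf rho x * (#|F|%:R^-1 +
    (1 - rho) ^+ weight (dsubmx v1)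
    * ((c - x * v1 ord0 ord0 == 0)%:R - #|F|%:R^-1))).
  apply: eq_bigr => x _; rewrite -IHn mulr_sumr [in RHS]big_mkcond.
  by apply: eq_bigr => r _; rewrite [in RHS]eq_sym subr_eq addrC eq_sym.
have weightE : weight v = ((v1 ord0 ord0 != 0%R) + weight (dsubmx v1))%N.
  rewrite /weight -!sum1dep_card [LHS]big_mkcond big_ord_recl.
  congr (_ + _)%N.
  rewrite [RHS]big_mkcond; apply: eq_bigr => j _; rewrite mxE.
  by have -> : rshift 1 j = lift ord0 j by apply: val_inj.
rewrite weightE sum_entry_pmf_mul mul0r subr0 big_split /= sum_constr.
rewrite -mulr_sumr big_split /= sum_constr.
have q0 := card_neq0.
case: (eqVneq (v1 ord0 ord0) 0) => [->|v0]; rewrite /= ?add0n ?add1n.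
  under eq_bigr do rewrite mulr0 subr0.
  rewrite sum_constr.
  move: (#|F|%:R) q0 ((1 - rho) ^+ _) ((c == 0)%:R) => Q q0 z d.
  by field.
(* As [v_0 != 0], only [x = c / v_0] contributes. *)
have -> : \sum_(x : F) (c - x * v1 ord0 ord0 == 0)%:R = 1 :> R.
  rewrite -[RHS](sum_delta (c / v1 ord0 ord0) (fun=> 1)).
  apply: eq_bigr => x _; rewrite mulr1 subr_eq0 eq_sym; congr (nat_of_bool _)%:R.
  exact: (can2_eq (mulfK v0) (divfK v0)).
rewrite exprS.
move: (#|F|%:R) q0 ((1 - rho) ^+ _) ((c == 0)%:R) => Q q0 z d.
by field.
Qed.

Lemma sum_row_pmf_orth rho n (v : 'cV[F]_n) :
  \sum_(r : 'rV[F]_n | r *m v == 0) row_pmf rho r = zero_prob rho (weight v).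
Proof.
transitivity (\sum_(r : 'rV[F]_n | (r *m v) ord0 ord0 == 0) row_pmf rho r).
  apply: eq_bigl => r; apply/eqP/eqP => [->|h]; first by rewrite mxE.
  by apply/matrixP => i j; rewrite !ord1 h mxE.
by rewrite sum_row_pmf_dot eqxx /zero_prob mulrC.
Qed.

(** The indicator of one entry is a product of factors that are 1 away from row [i] and column [j];
    all other rows and entries contribute their total mass 1. *)
Lemma expect_entry rho n k (i : 'I_k) (j : 'I_n) :
  \sum_(t : k.-tuple 'rV[F]_n) rows_pmf rho t * (tnth t i ord0 j != 0)%:R
  = rho * (1 - #|F|%:R^-1).
Proof.
pose f (i' : 'I_k) (r : 'rV[F]_n) : R :=
  row_pmf rho r * (if i' == i then (r ord0 j != 0)%:R else 1).
transitivity (\sum_(t : k.-tuple 'rV[F]_n | [forall i, xpredT (tnth t i)])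
    \prod_i f i (tnth t i)).
  apply: eq_big => [t|t _]; first by rewrite (introT forallP).
  rewrite big_split /= -/(rows_pmf rho t); congr (_ * _).
  by rewrite (bigD1 i) //= eqxx big1 ?mulr1 // => i' /negPf ->.
rewrite (@sum_tuple_prod _ _ k (fun=> xpredT)) (bigD1 i) //= [X in _ * X]big1.
  rewrite mulr1 /f eqxx.
  pose g (j' : 'I_n) (x : F) : R :=
    entry_pmf rho x * (if j' == j then (x != 0)%:R else 1).
  transitivity (\sum_(r : 'rV[F]_n) \prod_j' g j' (r ord0 j')).
    apply: eq_bigr => r _; rewrite big_split /=; congr (_ * _).
    by rewrite (bigD1 j) //= eqxx big1 ?mulr1 // => j' /negPf ->.
  rewrite sum_rV_prod (bigD1 j) //= [X in _ * X]big1 ?mulr1.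
    by rewrite /g eqxx sum_entry_pmf_neq0.
  move=> j' /negPf h; rewrite /g h -[RHS](sum_entry_pmf rho).
  by apply: eq_bigr => x _; rewrite mulr1.
move=> i' /negPf h; rewrite /f h -[RHS](sum_row_pmf rho n).
by apply: eq_bigr => x _; rewrite mulr1.
Qed.

Lemma expect_nonzero_entries rho n k :
  \sum_(t : k.-tuple 'rV[F]_n) rows_pmf rho t * (nonzero_entries t)%:R
  = (1 - #|F|%:R^-1) * rho * k%:R * n%:R.
Proof.
transitivity (\sum_(t : k.-tuple 'rV[F]_n) \sum_(ij : 'I_k * 'I_n)
   rows_pmf rho t * (tnth t ij.1 ord0 ij.2 != 0)%:R).
  apply: eq_bigr => t _; rewrite -mulr_sumr; congr (_ * _).
  rewrite /nonzero_entries -sum1dep_card natr_sum big_mkcond.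
  by apply: eq_bigr => ij _; case: eqP.
rewrite exchange_big /=.
under eq_bigr do rewrite expect_entry.
by rewrite sumr_const card_prod !card_ord -[LHS]mulr_natr natrM; ring.
Qed.

End SparseRows.

(** * Kernels, supports and their counting *)

Lemma castmx_mul_eq0 (F : fieldType) (p p' n l : nat) (e : p = p')
    (X : 'M[F]_(p, n)) (v : 'M[F]_(n, l)) :
  castmx (e, erefl n) X *m v = 0 -> X *m v = 0.
Proof. by case: p' / e; rewrite castmx_id. Qed.

Lemma singular_kernel (F : fieldType) (n : nat) (B : 'M[F]_n) :
  B \notin unitmx -> exists2 v : 'cV[F]_n, v != 0 & B *m v = 0.
Proof.
rewrite -unitmx_tr -row_free_unit -kermx_eq0 => /rowV0Pn[r /sub_kermxP rB r0].
exists r^T; first by rewrite trmx_eq0.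
by rewrite -[B]trmxK -trmx_mul rB trmx0.
Qed.

(** Take a basis of the kernel as the columns of [W^T]; its rank is [n - m], so some [n - m] of its
    rows form an invertible block, by whose inverse it is normalised. *)
Lemma kernel_param (F : fieldType) (m n : nat) (A : 'M[F]_(m, n)) :
  \rank A = m ->
  exists (K : 'M[F]_(n, n - m)) (f : 'I_(n - m) -> 'I_n),
    rowsub f K = 1%:M /\
    forall v : 'cV[F]_n, A *m v = 0 -> exists u, v = K *m u.
Proof.
move=> rA.
have rk : \rank (kermx A^T) = (n - m)%N by rewrite mxrank_ker mxrank_tr rA.
have [W Wfree kerW] : exists2 W : 'M[F]_(n - m, n), row_free W &
    forall r : 'rV[F]_n, r *m A^T = 0 -> (r <= W)%MS.
  rewrite -rk; exists (row_base (kermx A^T)); first exact: row_base_free.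
  by move=> r /sub_kermxP; rewrite eq_row_base.
have Wfull : row_full W^T by rewrite /row_full mxrank_tr.
pose f := fullrankfun Wfull.
have Uf : rowsub f W^T \in unitmx := fullrowsub_unit Wfull.
exists (W^T *m invmx (rowsub f W^T)), f; split.
  by rewrite -mul_rowsub_mx mulmxV.
move=> v Av.
have /submxP[D vD] : (v^T <= W)%MS by apply: kerW; rewrite -trmx_mul Av trmx0.
(* Here [v = W^T D^T], and the invertible block undoes the normalisation of [K]. *)
exists (rowsub f W^T *m D^T).
by rewrite mulmxA mulmxKV // -trmx_mul -vD trmxK.
Qed.

Lemma append_rows_singular (F : fieldType) (m n : nat) (hmn : (m <= n)%N)
    (A : 'M[F]_(m, n)) (K : 'M[F]_(n, n - m)) (t : (n - m).-tuple 'rV[F]_n) :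
  (forall v : 'cV[F]_n, A *m v = 0 -> exists u, v = K *m u) ->
  append_rows hmn A t \notin unitmx ->
  exists2 u : 'cV[F]_(n - m), u != 0 & forall i, tnth t i *m (K *m u) = 0.
Proof.
move=> kerA /singular_kernel[v v0 /castmx_mul_eq0].
rewrite mul_col_mx => /eqP; rewrite col_mx_eq0 => /andP[/eqP Av /eqP tv].
have [u vE] := kerA v Av; exists u.
  by apply: contraNneq v0 => u0; rewrite vE u0 mulmx0.
by move=> i; rewrite -vE -[tnth t i]/_ -(rowK (tnth t) i) -row_mul tv row0.
Qed.

Definition supp n (F : fieldType) (u : 'cV[F]_n) : {set 'I_n} :=
  [set j | u j ord0 != 0].

Lemma supp_eq0 n (F : fieldType) (u : 'cV[F]_n) :
  (supp u == set0) = (u == 0).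
Proof.
apply/eqP/eqP => [s0|->]; last by apply/setP => j; rewrite !inE mxE eqxx.
apply/colP => j; have /setP/(_ j) := s0.
by rewrite !inE mxE => /negbFE/eqP.
Qed.

(** Used to pad a set of spanning rows to the exact size counted by the union bound. *)
Lemma card_superset_exact (T : finType) (c : nat) (C0 : {set T}) :
  (#|C0| <= c <= #|T|)%N ->
  exists2 C : {set T}, #|C| = c & C0 \subset C.
Proof.
move=> /andP[C0c cT]; elim: c C0c cT => [|c IHc] C0c cT.
  by exists C0 => //; apply/eqP; rewrite -leqn0.
move: C0c; rewrite leq_eqVlt => /predU1P[<-|C0c]; first by exists C0.
have [C cardC sC] := IHc C0c (ltnW cT).
have /set0Pn[x] : ~: C != set0.
  by rewrite -card_gt0 -(leq_add2l #|C|) cardsC addn1 cardC.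
rewrite inE => xC; exists (x |: C); first by rewrite cardsU1 xC cardC.
by apply: subset_trans sC _; exact: subsetUr.
Qed.

Lemma mulmx_colsub_supp (F : fieldType) (l k : nat) (M : 'M[F]_(l, k))
    (I : {set 'I_k}) (u : 'cV[F]_k) :
  supp u \subset I ->
  colsub (@enum_val _ (mem I)) M *m rowsub (@enum_val _ (mem I)) u = M *m u.
Proof.
move=> suI; apply/matrixP => i j; rewrite !mxE.
rewrite (bigID (mem I)) /= [X in _ + X]big1 ?addr0; last first.
  move=> x xI; have : x \notin supp u by apply: contra xI; exact: subsetP.
  by rewrite inE negbK !ord1 => /eqP ->; rewrite mulr0.
rewrite (big_enum_val (fun x => M i x * u x j)) /=.
by apply: eq_bigr => x _; rewrite !mxE.
Qed.

(** The kernel vector [u] is a linear relation among the columns of [M] indexed by [supp u], so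
    these have rank below [#|supp u|]. A maximal independent set of rows of this submatrix spans its
    other rows, and [C] is any padding of it. *)
Lemma determining_rows (F : fieldType) (k : nat) (M : 'M[F]_k) (u : 'cV[F]_k) :
  u != 0 -> M *m u = 0 ->
  exists2 C : {set 'I_k}, #|C| = #|supp u|.-1 &
    forall u' : 'cV[F]_k, supp u' \subset supp u ->
      (forall i, i \in C -> row i M *m u' = 0) -> M *m u' = 0.
Proof.
move=> u0 Mu; pose f := @enum_val _ (mem (supp u)).
pose N := colsub f M.
have rN : (\rank N < #|supp u|)%N.
  (* A left inverse of [N] would make [u] vanish on its own support. *)
  rewrite ltn_neqAle rank_leq_col andbT; apply/negP => /row_fullP[B BN].
  have fu0 : rowsub f u = 0.
    by rewrite -[LHS]mul1mx -BN -mulmxA mulmx_colsub_supp // Mu mulmx0.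
  have /set0Pn[j ju] : supp u != set0 by rewrite supp_eq0.
  have /colP/(_ (enum_rank_in ju j)) := fu0.
  rewrite !mxE /f enum_rankK_in // => uj.
  by move: ju; rewrite inE uj eqxx.
pose C0 := [set maxrankfun N i | i : 'I_(\rank N)].
have [|C cardC sC] := @card_superset_exact _ #|supp u|.-1 C0.
  rewrite card_imset; last exact: maxrankfun_inj.
  rewrite card_ord; apply/andP; split; first by lia.
  by apply: leq_trans (leq_pred _) (max_card _).
exists C => // u' su' Cu'.
rewrite -(mulmx_colsub_supp M su') -/f -/N.
have /submxP[D ->] : (N <= rowsub (maxrankfun N) N)%MS by rewrite eq_maxrowsub.
rewrite -mulmxA; suff -> : rowsub (maxrankfun N) N *m rowsub f u' = 0.
  by rewrite mulmx0.
rewrite mul_rowsub_mx mulmx_colsub_supp //.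
apply/matrixP => i j; rewrite !ord1.
have := Cu' (maxrankfun N i) (subsetP sC _ (imset_f _ (erefl true))).
by rewrite -row_mul => /matrixP/(_ ord0 ord0); rewrite !mxE.
Qed.

(** Such columns are the functions from [I] to the nonzero scalars, extended by 0. *)
Lemma card_supp (F : finFieldType) (k : nat) (I : {set 'I_k}) :
  #|[set u : 'cV[F]_k | supp u == I]| = (#|F|.-1 ^ #|I|)%N.
Proof.
have <- : #|[pred x : F | x != 0]| = #|F|.-1.
  by rewrite -(cardC1 (0 : F)); apply: eq_card => x; rewrite !inE.
pose col (g : {ffun 'I_k -> F}) := \col_j g j.
have col_inj : injective col.
  move=> g h /colP gh; apply/ffunP => j.
  by have := gh j; rewrite !mxE.
rewrite -(card_pffun_on 0) -[RHS]cardsE -(card_imset _ col_inj).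
apply: eq_card => u; rewrite inE; apply/eqP/imsetP => [uI|[g]].
  exists [ffun j => u j ord0]; last by apply/colP => j; rewrite mxE ffunE.
  rewrite inE; apply/pffun_onP; split.
    apply/subsetP => j; rewrite unfold_in ffunE -uI inE //.
  by move=> _ /imageP[j jI ->]; rewrite ffunE inE; move: jI; rewrite -uI inE.
rewrite inE => /pffun_onP[/subsetP sg gI] ->; apply/setP => j.
rewrite inE mxE; apply/idP/idP => [|jI]; first by move=> ?; apply: sg.
by have := gI _ (image_f g jI); rewrite inE.
Qed.

(** Sets are grouped by size, the index [w] standing for size [w.+1]. The identity is first proved
    with the empty set included, whose term [h 0] is then cancelled. *)
Lemma sum_card_set (V : zmodType) (T : finType) (h : nat -> V) :
  \sum_(I : {set T} | I != set0) h #|I|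
  = \sum_(w < #|T|) h w.+1 *+ 'C(#|T|, w.+1).
Proof.
have tot : \sum_(I : {set T}) h #|I| = \sum_(w < #|T|.+1) h w *+ 'C(#|T|, w).
  have cardE (I : {set T}) : (@inord #|T| #|I| : nat) = #|I|.
    by rewrite inordK // ltnS max_card.
  rewrite (partition_big (fun I : {set T} => @inord #|T| #|I|) xpredT) //=.
  apply: eq_bigr => w _; rewrite -card_draws cardsE -sumr_const.
  apply: eq_big => [I|I /eqP <-]; last by rewrite cardE.
  by rewrite unfold_in -(inj_eq val_inj) /= cardE.
apply: (@addrI _ (h 0%N)); move: tot.
by rewrite (bigD1 set0) //= cards0 big_ord_recl bin0 mulr1n.
Qed.

(** * The two union bounds for degeneracy *)

Section Singular.
Variables (R : realFieldType) (F : finFieldType) (rho : R) (n k : nat).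
Hypothesis rho01 : 0 <= rho <= 1.
Variables (K : 'M[F]_(n, k)) (f : 'I_k -> 'I_n).
Hypothesis Kf : rowsub f K = 1%:M.

Definition killed (t : k.-tuple 'rV[F]_n) (u : 'cV[F]_k) : bool :=
  [forall i, tnth t i *m (K *m u) == 0].

(** By [append_rows_singular], this event contains the singularity of the completed matrix. *)
Definition degenerate (t : k.-tuple 'rV[F]_n) : bool :=
  [exists u : 'cV[F]_k, (u != 0) && killed t u].

(** The identity block copies every coordinate of [u] into [K *m u], at distinct places. *)
Lemma weight_mul_ge (u : 'cV[F]_k) : (#|supp u| <= weight (K *m u))%N.
Proof.
have fK j : (K *m u) (f j) ord0 = u j ord0.
  have : rowsub f K *m u = rowsub f (K *m u) by rewrite mul_rowsub_mx.
  by rewrite Kf mul1mx => /colP/(_ j); rewrite [RHS]mxE.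
have finj : injective f.
  move=> i j fij; apply/eqP; have /matrixP/(_ i j) := Kf.
  have /matrixP/(_ j j) := Kf; rewrite !mxE fij eqxx => -> /eqP.
  by case: (i == j) => //=; rewrite oner_eq0.
rewrite -(card_imset _ finj); apply/subset_leq_card/subsetP => _ /imsetP[j ju ->].
by move: ju; rewrite !inE fK.
Qed.

Lemma invq_bounds : 0 <= (#|F|%:R^-1 : R) <= 1.
Proof.
have q1 : (1 <= #|F|)%N by apply/card_gt0P; exists 0.
by rewrite invr_ge0 ler0n invf_le1 ?ler1n // ltr0n.
Qed.

Lemma zero_prob_ge0 w : 0 <= zero_prob F rho w.
Proof.
have /andP[q0 q1] := invq_bounds; have /andP[r0 r1] := rho01.
by rewrite addr_ge0 // mulr_ge0 ?exprn_ge0 // subr_ge0.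
Qed.

Lemma zero_prob_le w w' :
  (w <= w')%N -> zero_prob F rho w' <= zero_prob F rho w.
Proof.
have /andP[q0 q1] := invq_bounds; have /andP[r0 r1] := rho01.
move=> ww'; rewrite lerD2l ler_wpM2l ?subr_ge0 //.
by rewrite ler_wiXn2l ?subr_ge0 // gerBl.
Qed.

Lemma zero_prob_mul_le (u : 'cV[F]_k) :
  \sum_(r : 'rV[F]_n | r *m (K *m u) == 0) row_pmf rho r
  <= zero_prob F rho #|supp u|.
Proof. by rewrite sum_row_pmf_orth; apply/zero_prob_le/weight_mul_ge. Qed.

Lemma sum_killed_le (u : 'cV[F]_k) :
  \sum_(t | killed t u) rows_pmf rho t <= zero_prob F rho #|supp u| ^+ k.
Proof.
have -> := sum_rows_pmf_forall rho (fun (_ : 'I_k) r => r *m (K *m u) == 0).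
rewrite -[X in _ ^+ X](card_ord k) -prodr_const.
apply: ler_prod => i _; rewrite zero_prob_mul_le andbT.
by apply: sumr_ge0 => r _; exact: row_pmf_ge0.
Qed.

(* First moment: a degenerate [t] kills a whole punctured line of vectors,
   hence the gain of a factor [q - 1]. *)
Lemma degenerate_moment_bound :
  (#|F|%:R - 1) * \sum_(t | degenerate t) rows_pmf rho t
  <= \sum_(w < k) (#|F|%:R - 1) ^+ w.+1 * zero_prob F rho w.+1 ^+ k
                  *+ 'C(k, w.+1).
Proof.
have qE : #|F|%:R - 1 = #|F|.-1%:R :> R.
  have q1 : (0 < #|F|)%N by apply/card_gt0P; exists 0.
  by rewrite -[in LHS](prednK q1) -natr1 addrK.
rewrite qE.
have lines t : degenerate t ->
    #|F|.-1%:R <= \sum_(u : 'cV[F]_k | u != 0) (killed t u)%:R :> R.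
  case/existsP => u /andP[u0 tu].
  have uinj : injective (fun c : F => c *: u).
    move=> c d /eqP; rewrite -subr_eq0 -scalerBl scaler_eq0 (negPf u0) orbF.
    by rewrite subr_eq0 => /eqP.
  rewrite -natr_sum ler_nat -(cardC1 (0 : F)) -(card_imset _ uinj) -sum1_card.
  rewrite big_mkcond [leqRHS]big_mkcond; apply: leq_sum => v _.
  case: imsetP => // -[c]; rewrite !inE => c0 ->.
  rewrite scaler_eq0 negb_or c0 u0 /=.
  suff -> : killed t (c *: u) by [].
  apply/forallP => i; have /forallP/(_ i)/eqP h := tu.
  by rewrite -!scalemxAr h scaler0.
rewrite mulr_sumr.
(* Markov's inequality for the number of nonzero vectors killed by [t], after exchanging the
   sums. *)
apply: (@le_trans _ _ (\sum_(u : 'cV[F]_k | u != 0)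
   \sum_(t | killed t u) rows_pmf rho t)).
  rewrite [leRHS](exchange_big_dep xpredT) //= big_mkcond.
  apply: ler_sum => t _; case: ifP => [/lines h|_]; last first.
    by apply: sumr_ge0 => u _; exact: rows_pmf_ge0.
  apply: (le_trans (ler_wpM2r (rows_pmf_ge0 t rho01) h)).
  rewrite mulr_suml [leRHS]big_mkcondr; apply: ler_sum => u _.
  by case: killed; rewrite ?mul1r ?mul0r.
apply: (le_trans (ler_sum _ (fun u _ => sum_killed_le u))).
rewrite (partition_big (@supp k F) (fun I => I != set0)) /=; last first.
  by move=> u; rewrite supp_eq0.
have <- : \sum_(I : {set 'I_k} | I != set0)
    #|F|.-1%:R ^+ #|I| * zero_prob F rho #|I| ^+ k
  = \sum_(w < k) #|F|.-1%:R ^+ w.+1 * zero_prob F rho w.+1 ^+ k *+ 'C(k, w.+1).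
  rewrite (sum_card_set _ (fun w => #|F|.-1%:R ^+ w * zero_prob F rho w ^+ k)).
  by rewrite card_ord.
apply: ler_sum => I I0; rewrite -natrX -card_supp cardsE.
rewrite mulr_natl -sumr_const le_eqVlt; apply/orP; left; apply/eqP.
apply: eq_big => [u|u /andP[_ /eqP ->]] //.
rewrite -supp_eq0 -[RHS]/(supp u == I).
by case: (supp u =P I) => [->|_]; rewrite ?I0 ?andbF.
Qed.

(** What matters about this choice is that it depends only on the rows of [t] in [C]. *)
Definition guess (I C : {set 'I_k}) (t : k.-tuple 'rV[F]_n) : option 'cV[F]_k :=
  [pick u | (supp u == I) && [forall i in C, tnth t i *m (K *m u) == 0]].

Definition guessed (I C : {set 'I_k}) (t : k.-tuple 'rV[F]_n) : bool :=
  if guess I C t is Some u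
  then [forall (i | i \notin C), tnth t i *m (K *m u) == 0] else false.

(** Take [I = supp u] for a killed [u], and [C] its determining rows. The guess may differ from [u],
    but it has the same support and is killed by the rows in [C], hence by all rows. *)
Lemma degenerate_guessed t : degenerate t ->
  exists I C : {set 'I_k}, [/\ I != set0, #|C| = #|I|.-1 & guessed I C t].
Proof.
case/existsP => u /andP[u0 /forallP tu].
pose M : 'M[F]_k := (\matrix_i tnth t i) *m K.
have rowM i v : row i M *m v = tnth t i *m (K *m v).
  by rewrite row_mul rowK mulmxA.
have Mu : M *m u = 0.
  apply/row_matrixP => i; rewrite row_mul rowM row0; exact/eqP/tu.
have [C cardC CP] := determining_rows u0 Mu.
exists (supp u), C; split=> //; first by rewrite supp_eq0.
rewrite /guessed /guess; case: pickP => [v /andP[/eqP sv vC]|/(_ u)].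
  have Mv : M *m v = 0.
    apply: CP => [|i iC]; first by rewrite sv.
    by rewrite rowM; move/forall_inP: vC => /(_ i iC)/eqP.
  by apply/forall_inP => i _; rewrite -rowM -row_mul Mv row0.
by rewrite eqxx => /forall_inP[] i _; exact: tu.
Qed.

(** Erasing the rows outside [C] by zeros keeps the type of [t]; the fibres of this map express
    conditioning on the rows in [C]. *)
Definition restrict (C : {set 'I_k}) (t : k.-tuple 'rV[F]_n) :=
  [tuple (if i \in C then tnth t i else 0) | i < k].

Lemma tnth_restrict C t i :
  tnth (restrict C t) i = if i \in C then tnth t i else 0.
Proof. by rewrite tnth_mktuple. Qed.

Lemma guess_restrict I C t : guess I C (restrict C t) = guess I C t.
Proof.
apply: eq_pick => u /=; congr (_ && _).
by apply: eq_forallb_in => i iC; rewrite tnth_restrict iC.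
Qed.

(* Conditionally on the rows in [C], the guessed vector is fixed and the other
   rows must be orthogonal to its image. *)
Lemma sum_guessed_le (I C : {set 'I_k}) :
  \sum_(t | guessed I C t) rows_pmf rho t
  <= zero_prob F rho #|I| ^+ (k - #|C|).
Proof.
pose Q (i : 'I_k) (x : 'rV[F]_n) := (i \notin C) ==> (x == 0).
pose g (i : 'I_k) (x : 'rV[F]_n) : R := if i \in C then row_pmf rho x else 1.
(* The tuples [s] vanishing outside [C] are the values of [restrict C]; the product of the [g i] is
   their marginal mass. *)
have sum1 : \sum_(s : k.-tuple 'rV[F]_n | [forall i, Q i (tnth s i)])
    \prod_i g i (tnth s i) = 1.
  rewrite sum_tuple_prod big1 // => i _; rewrite /Q /g; case: (i \in C) => /=.
    exact: sum_row_pmf.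
  by rewrite big_pred1_eq.
rewrite (partition_big (restrict C) (fun s => [forall i, Q i (tnth s i)]));
  last first.
  move=> t _; apply/forallP => i; rewrite /Q tnth_restrict.
  by case: (i \in C); rewrite ?eqxx.
rewrite -[leRHS]mul1r -sum1 mulr_suml; apply: ler_sum => s _.
have g0 i x : 0 <= g i x by rewrite /g; case: ifP => // _; exact: row_pmf_ge0.
case E: (guess I C s) => [u|]; last first.
  rewrite big_pred0; last first.
    move=> t; apply/negP => /andP[+ /eqP sE].
    by rewrite /guessed -guess_restrict sE E.
  by rewrite mulr_ge0 ?prodr_ge0 // exprn_ge0 // zero_prob_ge0.
have su : supp u = I.
  by move: E; rewrite /guess; case: pickP => // v /andP[/eqP vI _] [<-].
pose Q' (i : 'I_k) (x : 'rV[F]_n) :=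
  if i \in C then x == tnth s i else x *m (K *m u) == 0.
(* On the fibre of [s] the guess is the fixed vector [u], so the event lies in a product event: rows
   in [C] prescribed, the others orthogonal to [K *m u]. *)
apply: (@le_trans _ _ (\sum_(t : k.-tuple 'rV[F]_n |
    [forall i, Q' i (tnth t i)]) rows_pmf rho t)).
  rewrite big_mkcond [leRHS]big_mkcond; apply: ler_sum => t _.
  case: ifP => [/andP[gt /eqP sE]|_]; last first.
    by case: ifP => // _; exact: rows_pmf_ge0.
  rewrite ifT //; apply/forallP => i; rewrite /Q' -sE tnth_restrict.
  case: (boolP (i \in C)) => // iC; move: gt.
  rewrite /guessed -guess_restrict sE E.
  by move=> /forallP/(_ i)/implyP; apply.
rewrite sum_rows_pmf_forall.
have -> : (k - #|C| = #|~: C|)%N by rewrite -{1}(card_ord k) -(cardsC C) addKn.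
rewrite -prodr_const [X in _ <= _ * X]big_mkcond -big_split /=.
apply: ler_prod => i _; rewrite sumr_ge0 /= => [|x _]; last exact: row_pmf_ge0.
rewrite /Q' /g in_setC; case: (i \in C) => /=.
  by rewrite mulr1 big_pred1_eq.
by rewrite mul1r -su zero_prob_mul_le.
Qed.

(** Union bound over the pairs [(I, C)] of [degenerate_guessed]; when [#|I| = w.+1], there are
    [k - w] rows outside [C]. *)
Lemma degenerate_guess_bound :
  \sum_(t | degenerate t) rows_pmf rho t
  <= \sum_(w < k) zero_prob F rho w.+1 ^+ (k - w) *+ 'C(k, w) *+ 'C(k, w.+1).
Proof.
apply: (@le_trans _ _ (\sum_(I : {set 'I_k} | I != set0)
   \sum_(C : {set 'I_k} | #|C| == #|I|.-1)
   \sum_(t | guessed I C t) rows_pmf rho t)).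
  have nneg t : 0 <= rows_pmf rho t by exact: rows_pmf_ge0.
  pose h I C t : R := if guessed I C t then rows_pmf rho t else 0.
  have h0 I C t : 0 <= h I C t by rewrite /h; case: ifP.
  have -> : \sum_(I : {set 'I_k} | I != set0)
      \sum_(C : {set 'I_k} | #|C| == #|I|.-1)
      \sum_(t | guessed I C t) rows_pmf rho t
    = \sum_t \sum_(I : {set 'I_k} | I != set0)
      \sum_(C : {set 'I_k} | #|C| == #|I|.-1) h I C t.
    rewrite exchange_big /=; apply: eq_bigr => I _.
    rewrite exchange_big /=; apply: eq_bigr => C _.
    by rewrite big_mkcond.
  rewrite big_mkcond; apply: ler_sum => t _; case: ifP => [|_]; last first.
    by do 2!(apply: sumr_ge0 => ? _).
  move=> /degenerate_guessed[I [C [I0 cC gt]]].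
  rewrite (bigD1 I I0) /= [X in _ <= X + _](bigD1 C) /=; last exact/eqP.
  rewrite {1}/h gt -addrA lerDl addr_ge0 //; first by apply: sumr_ge0.
  by do 2!(apply: sumr_ge0 => ? _).
have -> : \sum_(w < k) zero_prob F rho w.+1 ^+ (k - w) *+ 'C(k, w) *+ 'C(k, w.+1)
  = \sum_(I : {set 'I_k} | I != set0)
      zero_prob F rho #|I| ^+ (k - #|I|.-1) *+ 'C(k, #|I|.-1).
  by rewrite (sum_card_set _ (fun w =>
    zero_prob F rho w ^+ (k - w.-1) *+ 'C(k, w.-1))) card_ord.
apply: ler_sum => I I0.
have -> : 'C(k, #|I|.-1) = #|[set C : {set 'I_k} | #|C| == #|I|.-1]|.
  by rewrite card_draws card_ord.
rewrite -sumr_const big_mkcond [leRHS]big_mkcond; apply: ler_sum => C _.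
by rewrite inE; case: eqP => // <-; exact: sum_guessed_le.
Qed.

End Singular.

(** * Elementary bounds on binomials and powers *)

Lemma ffact_le_exp (k m : nat) : (k ^_ m <= k ^ m)%N.
Proof.
elim: m => [|m IHm]; first by rewrite ffactn0.
by rewrite ffactnSr expnSr leq_mul // leq_subr.
Qed.

Lemma bin_le_exp (k m : nat) : ('C(k, m) <= k ^ m)%N.
Proof.
apply: leq_trans (ffact_le_exp k m).
by rewrite -bin_ffact leq_pmulr // fact_gt0.
Qed.

(** Follows from [2^m <= 2 m!]. The factor [2^m] brings the ratio in [guess_term_large] from 3/2
    down to 3/4. *)
Lemma bin_mul_exp2_le (k m : nat) : ('C(k, m) * 2 ^ m <= 2 * k ^ m)%N.
Proof.
have fact2 : (2 ^ m <= 2 * m`!)%N.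
  elim: m => // -[|m] IHm //; rewrite factS expnS.
  by rewrite mulnCA leq_mul.
apply: leq_trans (leq_mul (leqnn _) fact2) _.
by rewrite mulnCA bin_ffact leq_mul // ffact_le_exp.
Qed.

Lemma bin_le_exp2 (k m : nat) : ('C(k, m) <= 2 ^ k)%N.
Proof.
elim: k m => [|k IHk] [|m]; rewrite ?bin0 ?expn_gt0 // binS expnS mul2n -addnn.
exact: leq_add.
Qed.

(** Serves to clear fractional exponents. *)
Lemma le_of_expr (R : realDomainType) (m : nat) (u v : R) :
  0 <= u -> 0 <= v -> u ^+ m.+1 <= v ^+ m.+1 -> u <= v.
Proof. by move=> u0 v0; rewrite ler_pXn2r. Qed.

Lemma sum_bin_exp_le (R : numDomainType) (k : nat) (y : R) : 0 <= y ->
  \sum_(w < k) y ^+ w.+1 *+ 'C(k, w.+1) <= (1 + y) ^+ k.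
Proof.
move=> y0; rewrite exprDn big_ord_recl.
under [X in _ <= _ + X]eq_bigr do rewrite expr1n mul1r.
by rewrite lerDr mulrn_wge0 // expr0 mulr1 expr1n.
Qed.

(** * Numerical estimates of the two sums *)

(* Here [x] stands for [1 - rho], [q >= 16 * 18 + 9 = 297] and
   [k >= 1236] because [upsilon >= (167 / 5) * 37 > 1235]. *)
Section Tails.
Variables (R : realType) (k n q : nat) (x : R).
Hypotheses (k_ge : (1236 <= k)%N) (k_le : (k <= n)%N) (q_ge : (297 <= q)%N).
Hypotheses (x01 : 0 <= x <= 1) (xk : x ^+ k <= n%:R^-1 ^+ 6).
Let Q : R := q%:R.
Let V : R := n%:R.
Let b w : R := Q^-1 + (1 - Q^-1) * x ^+ w.

Let Q_ge : 297 <= Q. Proof. by rewrite (ler_nat _ 297). Qed.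
Let V_ge : 1236 <= V.
Proof. by rewrite (ler_nat _ 1236) (leq_trans k_ge). Qed.
Let Q_gt0 : 0 < Q. Proof. by apply: lt_le_trans Q_ge. Qed.
Let V_gt0 : 0 < V. Proof. by apply: lt_le_trans V_ge. Qed.
Let iQ_gt0 : 0 < Q^-1. Proof. by rewrite invr_gt0. Qed.
Let Q_ge0 : 0 <= Q. Proof. exact: ltW. Qed.
Let V_ge0 : 0 <= V. Proof. exact: ltW. Qed.
Let iQ_ge0 : 0 <= Q^-1. Proof. exact: ltW. Qed.
Let iV_gt0 : 0 < V^-1. Proof. by rewrite invr_gt0. Qed.
Let iV_ge0 : 0 <= V^-1. Proof. exact: ltW. Qed.
Let Q1_ge0 : 0 <= Q - 1. Proof. by move: Q_ge; lra. Qed.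
Let iQ_le : Q^-1 <= 297^-1. Proof. by rewrite lef_pV2 // posrE. Qed.
Let iV_le : V^-1 <= 1236^-1. Proof. by rewrite lef_pV2 // posrE. Qed.
Let QK : Q * Q^-1 = 1. Proof. by rewrite mulfV // gt_eqF. Qed.
Let VK : V * V^-1 = 1. Proof. by rewrite mulfV // gt_eqF. Qed.

Let VXK a : V^-1 ^+ a * V ^+ a = 1.
Proof. by rewrite -exprMn mulrC VK expr1n. Qed.

Let xw_bounds w : 0 <= x ^+ w <= 1.
Proof.
by case/andP: x01 => x0 x1; rewrite exprn_ge0 //= exprn_ile1.
Qed.

Let b_ge0 w : 0 <= b w.
Proof.
have /andP[y0 y1] := xw_bounds w.
by rewrite addr_ge0 ?mulr_ge0 // ?ltW //; move: iQ_le; lra.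
Qed.

Let b_le w : b w <= Q^-1 + x ^+ w.
Proof.
have /andP[y0 y1] := xw_bounds w.
by rewrite lerD2l ler_piMl // gerBl ltW.
Qed.

(** [x^(cw) <= (x^k)^d]: a form of [x^w <= n^(-6w/k)] with integer exponents. *)
Let x_pow w c d : (d * k <= c * w)%N -> (x ^+ w) ^+ c <= V^-1 ^+ (6 * d).
Proof.
move=> h; have /andP[x0 x1] := x01.
rewrite -exprM [(w * c)%N]mulnC.
apply: le_trans (ler_wiXn2l x0 x1 h) _.
by rewrite mulnC exprM exprM lerXn2r // ?nnegrE ?exprn_ge0 // ltW.
Qed.

(* With [a = 1/q] and [y = x ^ w]:
   [y - (a + (1 - a) y)^2 = (1 - y) ((1 - a)^2 y - a^2)]. *)
Let b_sqr_le w : 1 <= Q * x ^+ w -> b w ^+ 2 <= x ^+ w.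
Proof.
have /andP[y0 y1] := xw_bounds w; rewrite /b => Qy.
have ay : Q^-1 <= x ^+ w by rewrite -[Q^-1]mulr1 ler_pdivrMl.
move: (Q^-1) (x ^+ w) iQ_gt0 iQ_le y0 y1 ay => a y a0 a1 y0 y1 ay.
rewrite -subr_ge0.
have -> : y - (a + (1 - a) * y) ^+ 2 = (1 - y) * ((1 - a) ^+ 2 * y - a ^+ 2).
  by ring.
rewrite mulr_ge0 ?subr_ge0 //.
have h1 : a ^+ 2 <= 4^-1 * y by nra.
have h2 : 4^-1 <= (1 - a) ^+ 2 by nra.
by apply: le_trans h1 _; rewrite ler_wpM2r.
Qed.

(** The regime complementary to [b_sqr_le], where the uniform part [1/q] dominates. *)
Let b_le_2iQ w : Q * x ^+ w < 1 -> b w <= 2 / Q.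
Proof.
move=> h; apply: le_trans (b_le w) _.
have : x ^+ w <= Q^-1 by rewrite -[Q^-1]mulr1 ler_pdivlMl // ltW.
by lra.
Qed.

(** [(1 + c)^k <= e^(ck) <= e], and [e <= 4] because [e^(-1/2) >= 1/2]. *)
Let pow1D_le (c : R) : 0 <= c -> c * k%:R <= 1 -> (1 + c) ^+ k <= 4.
Proof.
move=> c0 ck.
apply: (@le_trans _ _ (expR 1)).
  apply: (@le_trans _ _ (expR c ^+ k)).
    by rewrite lerXn2r ?nnegrE ?expR_ge1Dx ?expR_ge0 ?addr_ge0.
  by rewrite -expRM_natr ler_expR.
have h : 2^-1 <= expR (- 2^-1 : R).
  by apply: le_trans (expR_ge1Dx _); lra.
have h' : expR (2^-1 : R) <= 2.
  rewrite -[leRHS]invrK -[leLHS]invrK.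
  by rewrite lef_pV2 ?posrE ?invr_gt0 ?expR_gt0 // -expRN.
have -> : 1 = 2^-1 + 2^-1 :> R by lra.
rewrite expRD; have := expR_gt0 (2^-1 : R); nra.
Qed.

Let bin_real_le m : 'C(k, m)%:R <= V ^+ m.
Proof.
rewrite -natrX ler_nat; apply: leq_trans (bin_le_exp k m) _.
by case: m => // m; rewrite leq_exp2r.
Qed.

Let small_half w : (k <= 2 * w)%N -> x ^+ w <= V^-1 ^+ 3.
Proof.
move=> h; have /andP[y0 _] := xw_bounds w.
apply: (@le_of_expr _ 1) => //; first by rewrite exprn_ge0.
by rewrite -[leRHS]exprM; apply: (@x_pow w 2 1); rewrite mul1n.
Qed.

(** With [W = w.+1], [b_sqr_le] gives [b^k <= x^(Wk/2) <= n^(-3W)], against [(q-1)^w <= n^(2w)] and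
    a binomial at most [n^W]. *)
Let moment_term_small w : (q <= n ^ 2)%N -> 1 <= Q * x ^+ w.+1 ->
  (Q - 1) ^+ w.+1 * b w.+1 ^+ k *+ 'C(k, w.+1) <= (Q - 1) * V^-1 ^+ 2.
Proof.
move=> qn Qx.
have bk : b w.+1 ^+ k <= V^-1 ^+ (3 * w.+1).
  apply: (@le_of_expr _ 1); rewrite ?exprn_ge0 //.
  rewrite -exprM -exprM mulnC exprM.
  apply: (@le_trans _ _ ((x ^+ w.+1) ^+ k)).
    rewrite lerXn2r ?nnegrE ?exprn_ge0 ?b_sqr_le //; by case/andP: x01.
  have -> : (3 * w.+1 * 2 = 6 * w.+1)%N by clear; lia.
  by apply: x_pow; rewrite mulnC leqnn.
have QV : Q - 1 <= V ^+ 2.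
  have : Q <= V ^+ 2 by rewrite -natrX ler_nat.
  by lra.
rewrite -[leLHS]mulr_natr exprS -!mulrA ler_wpM2l //.
apply: (@le_trans _ _ ((V ^+ 2) ^+ w * (V^-1 ^+ (3 * w.+1) * V ^+ w.+1))).
  apply: ler_pM; rewrite ?exprn_ge0 ?mulr_ge0 ?exprn_ge0 //.
    by rewrite lerXn2r // nnegrE exprn_ge0 // ltW.
  by apply: ler_pM; rewrite ?exprn_ge0 // bin_real_le.
have -> : (3 * w.+1 = w * 2 + w.+1 + 2)%N by clear; lia.
rewrite !(exprD V^-1) -exprM (mulnC 2%N).
set u := V ^+ (w * 2); set v := V ^+ w.+1.
set u' := V^-1 ^+ (w * 2); set v' := V^-1 ^+ w.+1.
have -> : u * (u' * v' * V^-1 ^+ 2 * v) = (u' * u) * (v' * v) * V^-1 ^+ 2 by ring.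
by rewrite !VXK !mul1r lexx.
Qed.

Let moment_term_mid w : Q * x ^+ w < 1 -> (2 * w <= k)%N ->
  (Q - 1) ^+ w * b w ^+ k *+ 'C(k, w) <= (2 / 17) ^+ k *+ 'C(k, w).
Proof.
move=> Qx wk; rewrite lerMn2r; apply/orP; right.
have bk : b w ^+ k <= 2 ^+ k * Q^-1 ^+ k.
  by rewrite -exprMn lerXn2r ?nnegrE ?mulr_ge0 // b_le_2iQ.
(* At least [k/2] factors [1/q] survive, and [q >= 17^2]. *)
have Qw : (Q - 1) ^+ w * Q^-1 ^+ k <= 17^-1 ^+ k.
  apply: (@le_trans _ _ (Q ^+ w * Q^-1 ^+ k)).
    by rewrite ler_wpM2r ?exprn_ge0 // lerXn2r ?nnegrE // gerBl.
  have -> : Q ^+ w * Q^-1 ^+ k = Q^-1 ^+ (k - w).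
    rewrite -{1}(subnK (_ : w <= k)%N); last by move: wk; clear; lia.
    by rewrite exprD mulrCA -exprMn QK expr1n mulr1.
  apply: (@le_of_expr _ 1); rewrite ?exprn_ge0 ?invr_ge0 //.
  rewrite -!exprM.
  apply: (@le_trans _ _ (Q^-1 ^+ k)).
    rewrite ler_wiXn2l //; first by move: iQ_le; lra.
    by move: wk; clear; lia.
  rewrite mulnC exprM lerXn2r ?nnegrE ?exprn_ge0 ?invr_ge0 //.
  by move: iQ_le; lra.
rewrite exprMn mulrC.
apply: le_trans (ler_wpM2r _ bk) _; first by rewrite exprn_ge0.
by rewrite -mulrA ler_wpM2l ?exprn_ge0 // mulrC.
Qed.

(** Here [x^w <= n^(-3) <= 1/(qk)], so [b <= (1 + 1/k)/q]. *)
Let moment_term_large w : (q <= n ^ 2)%N -> (k <= 2 * w)%N ->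
  (Q - 1) ^+ w * b w ^+ k *+ 'C(k, w)
  <= 4 * Q^-1 ^+ k * ((Q - 1) ^+ w *+ 'C(k, w)).
Proof.
move=> qn wk; rewrite mulrnAr lerMn2r; apply/orP; right.
rewrite [leRHS]mulrC ler_wpM2l ?exprn_ge0 //.
have k0 : 0 < k%:R :> R by rewrite ltr0n; move: k_ge; clear; lia.
apply: (@le_trans _ _ ((Q^-1 * (1 + k%:R^-1)) ^+ k)).
  have c0 : 0 <= Q^-1 * (1 + k%:R^-1) by rewrite mulr_ge0 // addr_ge0 ?invr_ge0.
  rewrite lerXn2r ?nnegrE //.
  apply: le_trans (b_le w) _; rewrite mulrDr mulr1 lerD2l.
  apply: le_trans (small_half wk) _.
  apply: (@le_trans _ _ (V^-1 ^+ 2 * V^-1)); first by rewrite -exprSr.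
  apply: ler_pM; rewrite ?exprn_ge0 //.
    by rewrite exprVn lef_pV2 ?posrE ?exprn_gt0 // -natrX ler_nat.
  by rewrite lef_pV2 ?posrE // ler_nat.
rewrite exprMn mulrC ler_wpM2r ?exprn_ge0 //.
by apply: pow1D_le; rewrite ?invr_ge0 ?mulVf // gt_eqF.
Qed.

Lemma moment_sum_le : (q <= n ^ 2)%N ->
  \sum_(w < k) (Q - 1) ^+ w.+1 * b w.+1 ^+ k *+ 'C(k, w.+1) <= (Q - 1) / 9.
Proof.
move=> qn.
(* Each term obeys one of the three bounds, so their sum dominates. The totals are at most
   [(q-1)/1236], [(4/17)^k <= 1] and 4. *)
apply: (@le_trans _ _ (\sum_(w < k) ((Q - 1) * V^-1 ^+ 2
    + (2 / 17) ^+ k * (1 ^+ w.+1 *+ 'C(k, w.+1))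
    + 4 * Q^-1 ^+ k * ((Q - 1) ^+ w.+1 *+ 'C(k, w.+1))))).
  apply: ler_sum => w _.
  have t1 : 0 <= (Q - 1) * V^-1 ^+ 2 by rewrite mulr_ge0 ?exprn_ge0.
  have t2 : 0 <= (2 / 17) ^+ k * (1 ^+ w.+1 *+ 'C(k, w.+1)) :> R.
    by rewrite expr1n mulr_ge0 ?exprn_ge0 ?divr_ge0.
  have t3 : 0 <= 4 * Q^-1 ^+ k * ((Q - 1) ^+ w.+1 *+ 'C(k, w.+1)).
    by rewrite !mulr_ge0 ?mulrn_wge0 ?exprn_ge0.
  have [Qx|Qx] := leP 1 (Q * x ^+ w.+1).
    by apply: le_trans (moment_term_small qn Qx) _; rewrite -addrA lerDl addr_ge0.
  have [wk|wk] := leqP (2 * w.+1) k.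
    apply: le_trans (moment_term_mid Qx wk) _.
    by rewrite -[leLHS]mulr_natr expr1n addrAC lerDr addr_ge0.
  by apply: le_trans (moment_term_large qn (ltnW wk)) _; rewrite lerDr addr_ge0.
rewrite !big_split /= sumr_const card_ord -!mulr_sumr.
have s2 : (2 / 17) ^+ k * \sum_(w < k) (1 ^+ w.+1 *+ 'C(k, w.+1)) <= 1 :> R.
  apply: le_trans (ler_wpM2l _ (sum_bin_exp_le k ler01)) _.
    by rewrite exprn_ge0 ?divr_ge0.
  by rewrite -exprMn exprn_ile1 //; lra.
have s3 : 4 * Q^-1 ^+ k * \sum_(w < k) ((Q - 1) ^+ w.+1 *+ 'C(k, w.+1)) <= 4.
  apply: le_trans (ler_wpM2l _ (sum_bin_exp_le k Q1_ge0)) _.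
    by rewrite mulr_ge0 ?exprn_ge0.
  by rewrite addrC subrK -mulrA -exprMn [Q^-1 * Q]mulrC QK expr1n mulr1.
have s1 : ((Q - 1) * V^-1 ^+ 2) *+ k <= (Q - 1) * 1236^-1.
  rewrite -[leLHS]mulr_natr -mulrA ler_wpM2l //.
  apply: le_trans iV_le; rewrite expr2 -mulrA ger_pMr // mulrC.
  by rewrite ler_pdivrMr // mul1r ler_nat.
apply: le_trans (lerD (lerD s1 s2) s3) _.
by move: Q_ge; lra.
Qed.

(** Squared, with [W = w.+1]: [b^(2(k-w)) <= x^(W(k-w)) <= n^(-5W)] as [k - w >= 5k/6], and the
    binomials give at most [n^(4w+2)]. What remains is at most [n^(-3) <= n^(-2)/900]. *)
Let guess_term_small w : (n ^ 2 < q)%N -> 1 <= Q * x ^+ w.+1 ->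
  (6 * w.+1 <= k)%N ->
  b w.+1 ^+ (k - w) *+ 'C(k, w) *+ 'C(k, w.+1) <= V^-1 / 30.
Proof.
move=> qn Qx wk.
have bk : (b w.+1 ^+ (k - w)) ^+ 2 <= V^-1 ^+ (5 * w.+1).
  apply: (@le_of_expr _ 5); rewrite ?exprn_ge0 //.
  rewrite -!exprM.
  have -> : ((k - w) * 2 * 6 = 2 * (6 * (k - w)))%N by clear; lia.
  rewrite exprM.
  apply: (@le_trans _ _ ((x ^+ w.+1) ^+ (6 * (k - w)))).
    by rewrite lerXn2r ?nnegrE ?exprn_ge0 ?b_sqr_le //; case/andP: x01.
  have -> : (5 * w.+1 * 6 = 6 * (5 * w.+1))%N by clear; lia.
  by apply: x_pow; move: wk; clear; nia.
rewrite -mulrnA -[leLHS]mulr_natr natrM.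
apply: (@le_of_expr _ 1); rewrite ?mulr_ge0 ?exprn_ge0 ?invr_ge0 //.
rewrite exprMn.
apply: (@le_trans _ _ (V^-1 ^+ (5 * w.+1) * (V ^+ w * V ^+ w.+1) ^+ 2)).
  apply: ler_pM; rewrite ?exprn_ge0 ?mulr_ge0 //.
  by rewrite lerXn2r ?nnegrE ?mulr_ge0 ?exprn_ge0 // ler_pM ?bin_real_le.
rewrite -exprD -exprM.
have -> : (5 * w.+1 = (w + w.+1) * 2 + (w + 3))%N by clear; lia.
rewrite exprD mulrAC VXK mul1r.
apply: (@le_trans _ _ (V^-1 ^+ 3)).
  by rewrite ler_wiXn2l //; [move: iV_le; lra | clear; lia].
by move: (V^-1) iV_ge0 iV_le => v v0 v1; nra.
Qed.

(** The square is at most [(2/n)^k 16^k = (32/n)^k], since both binomials are at most [2^k]; six of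
    these factors suffice. *)
Let guess_term_mid w : b w.+1 <= 2 * V^-1 -> (2 * w.+1 <= k)%N ->
  b w.+1 ^+ (k - w) *+ 'C(k, w) *+ 'C(k, w.+1) <= V^-1 / 30.
Proof.
move=> bw wk; rewrite -mulrnA -[leLHS]mulr_natr natrM.
apply: (@le_of_expr _ 1); rewrite ?mulr_ge0 ?exprn_ge0 ?invr_ge0 //.
have v2 : 2 * V^-1 <= 1 by move: iV_le; lra.
rewrite exprMn.
apply: (@le_trans _ _ ((2 * V^-1) ^+ k * (2 ^+ k * 2 ^+ k) ^+ 2)).
  apply: ler_pM; rewrite ?exprn_ge0 ?mulr_ge0 //.
    rewrite -exprM; apply: (@le_trans _ _ ((2 * V^-1) ^+ ((k - w) * 2))).
      by rewrite lerXn2r ?nnegrE ?mulr_ge0.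
    by rewrite ler_wiXn2l ?mulr_ge0 //; move: wk; clear; lia.
  rewrite lerXn2r ?nnegrE ?mulr_ge0 ?exprn_ge0 //.
  by rewrite ler_pM // -natrX ler_nat bin_le_exp2.
rewrite -!exprMn -exprM mulnC exprM -exprMn.
apply: (@le_trans _ _ ((2 * V^-1 * (2 * 2) ^+ 2) ^+ 6)).
  rewrite ler_wiXn2l ?mulr_ge0 ?exprn_ge0 //; last by move: k_ge; clear; lia.
  by move: iV_le; lra.
have -> : (2 * V^-1 * (2 * 2) ^+ 2) ^+ 6 = (V^-1) ^+ 2 * (32 ^+ 6 * (V^-1) ^+ 4).
  by ring.
have -> : (V^-1 / 30) ^+ 2 = V^-1 ^+ 2 * 900^-1 by move: (V^-1) => v; field.
rewrite ler_wpM2l ?exprn_ge0 //.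
apply: (@le_trans _ _ (32 ^+ 6 * (1236^-1) ^+ 4)); last by lra.
by rewrite ler_wpM2l ?exprn_ge0 // lerXn2r // ?nnegrE ?invr_ge0.
Qed.

(** Here [b <= (3/2) n^(-2)]. With [k - w = e.+1], the binomials by symmetry are at most [n^e] and
    [2 (n/2)^(e+1)], leaving one factor [1/n]. *)
Let guess_term_large w : (n ^ 2 < q)%N -> (k <= 2 * w.+1)%N -> (w < k)%N ->
  b w.+1 ^+ (k - w) *+ 'C(k, w) *+ 'C(k, w.+1)
  <= 2 * V^-1 * (3 / 4) ^+ (k - w).
Proof.
move=> qn wk wltk.
have bw : b w.+1 <= V^-1 ^+ 2 * (3 / 2).
  apply: le_trans (b_le _) _.
  have h1 : Q^-1 <= V^-1 ^+ 2.
    by rewrite exprVn lef_pV2 ?posrE ?exprn_gt0 // -natrX ler_nat ltnW.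
  have h2 := small_half wk; apply: le_trans (lerD h1 h2) _.
  by move: (V^-1) iV_ge0 iV_le => v v0 v1; nra.
have [e ke] : exists e, (k - w = e.+1)%N.
  by exists (k - w).-1; move: wltk; clear; lia.
have c1 : 'C(k, w.+1)%:R <= V ^+ e.
  rewrite -bin_sub // (_ : k - w.+1 = e)%N ?bin_real_le //.
  by move: ke; clear; lia.
have c2 : 'C(k, w)%:R * 2 ^+ e.+1 <= 2 * V ^+ e.+1.
  have := bin_mul_exp2_le k e.+1.
  rewrite -(ler_nat R) !natrM !natrX -{1}ke bin_sub ?(ltnW wltk) // => h.
  by apply: le_trans h _; rewrite ler_wpM2l // lerXn2r ?nnegrE // ler_nat.
rewrite ke -mulrnA -[leLHS]mulr_natr natrM.
have -> : (3 / 4 : R) = 3 / 2 * 2^-1 by lra.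
apply: (@le_trans _ _ ((V^-1 ^+ 2 * (3 / 2)) ^+ e.+1
     * (2 * V ^+ e.+1 * 2^-1 ^+ e.+1 * V ^+ e))).
  apply: ler_pM; rewrite ?exprn_ge0 ?mulr_ge0 //.
    by rewrite lerXn2r ?nnegrE ?mulr_ge0 ?exprn_ge0 ?invr_ge0.
  apply: ler_pM => //.
  have -> : 'C(k, w)%:R = 'C(k, w)%:R * 2 ^+ e.+1 * 2^-1 ^+ e.+1 :> R.
    by rewrite exprVn mulfK // expf_neq0 // pnatr_eq0.
  by rewrite ler_wpM2r ?exprn_ge0 ?invr_ge0.
have -> : (V^-1 ^+ 2 * (3 / 2)) ^+ e.+1 * (2 * V ^+ e.+1 * 2^-1 ^+ e.+1 * V ^+ e)
  = 2 * (V^-1 ^+ e.+1 * V ^+ e.+1) * (V^-1 ^+ e * V ^+ e) * V^-1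
    * ((3 / 2) ^+ e.+1 * 2^-1 ^+ e.+1).
  rewrite (exprMn _ (V^-1 ^+ 2)) exprAC expr2.
  rewrite [in LHS](exprS V^-1) [in RHS](exprS V^-1).
  move: (V^-1 ^+ e) (V ^+ e) (V ^+ e.+1) V^-1 (2^-1 ^+ e.+1) ((3 / 2) ^+ e.+1).
  by move=> a c d v g h; ring.
by rewrite !VXK -exprMn !mulr1 lexx.
Qed.

Lemma guess_sum_le : (n ^ 2 < q)%N ->
  \sum_(w < k) b w.+1 ^+ (k - w) *+ 'C(k, w) *+ 'C(k, w.+1) <= 9^-1.
Proof.
move=> qn.
have geo (m : nat) : \sum_(i < m) (3 / 4) ^+ i.+1 <= 3 - 3 * (3 / 4) ^+ m :> R.
  elim: m => [|m IHm]; first by rewrite big_ord0; lra.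
  by rewrite big_ord_recr /= exprS; lra.
apply: (@le_trans _ _ (\sum_(w < k) (V^-1 / 30 + 2 * V^-1 * (3 / 4) ^+ (k - w)))).
  apply: ler_sum => w _.
  have t1 : 0 <= V^-1 / 30 by rewrite divr_ge0.
  have t2 : 0 <= 2 * V^-1 * (3 / 4) ^+ (k - w).
    by rewrite !mulr_ge0 ?exprn_ge0 ?divr_ge0.
  have [wk|wk] := leqP (2 * w.+1) k; last first.
    apply: le_trans (guess_term_large qn (ltnW wk) (ltn_ord w)) _.
    by rewrite lerDr.
  suff h : b w.+1 ^+ (k - w) *+ 'C(k, w) *+ 'C(k, w.+1) <= V^-1 / 30.
    by apply: le_trans h _; rewrite lerDl.
  have QV : Q^-1 <= V^-1.
    rewrite lef_pV2 ?posrE // ler_nat; apply: leq_trans (ltnW qn).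
    by rewrite -mulnn leq_pmulr //; move: k_ge k_le; clear; lia.
  have [Qx|Qx] := leP 1 (Q * x ^+ w.+1); last first.
    apply: guess_term_mid => //; apply: le_trans (b_le_2iQ Qx) _.
    by rewrite ler_wpM2l.
  have [wk6|wk6] := leqP (6 * w.+1) k; first exact: guess_term_small.
  (* For [w.+1 > k/6] both [1/q] and [x^(w+1)] are at most [1/n]. *)
  apply: guess_term_mid => //; apply: le_trans (b_le _) _.
  have : x ^+ w.+1 <= V^-1.
    have /andP[y0 _] := xw_bounds w.+1.
    apply: (@le_of_expr _ 5) => //.
    by apply: (@x_pow w.+1 6 1); rewrite mul1n ltnW.
  by move: QV; lra.
rewrite big_split /= sumr_const card_ord -mulr_sumr.
rewrite (reindex_inj rev_ord_inj) /=.
have -> : \sum_(j < k) (3 / 4 : R) ^+ (k - (k - j.+1))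
    = \sum_(j < k) (3 / 4) ^+ j.+1.
  by apply: eq_bigr => j _; rewrite subKn.
have s1 : (V^-1 / 30) *+ k <= 30^-1.
  rewrite -[leLHS]mulr_natr mulrAC ger_pMl ?invr_gt0 //.
  by rewrite mulrC ler_pdivrMr // mul1r ler_nat.
have s2 : 2 * V^-1 * \sum_(j < k) (3 / 4 : R) ^+ j.+1 <= 2 * 1236^-1 * 3.
  apply: ler_pM; rewrite ?mulr_ge0 ?sumr_ge0 //.
  - by move=> j _; rewrite exprn_ge0 ?divr_ge0.
  - by rewrite ler_wpM2l.
  - apply: le_trans (geo k) _.
    have : 0 <= (3 / 4 : R) ^+ k by rewrite exprn_ge0 ?divr_ge0.
    by lra.
by apply: le_trans (lerD s1 s2) _; lra.
Qed.

End Tails.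

(** * The random procedure and its guarantees *)

Definition random_rows (R : realType) (F : finFieldType) (rho : R)
    (rho01 : 0 <= rho <= 1) (n k : nat) : distr R (k.-tuple 'rV[F]_n) :=
  Distr (fun t => rows_pmf_ge0 t rho01) (sum_rows_pmf F rho n k).

(** The law must not depend on [A], while [K] and [f] do; hence the degeneracy bound is assumed
    uniformly in them. *)
Lemma prob_unit_ge (R : realType) (F : finFieldType) (rho : R)
    (rho01 : 0 <= rho <= 1) (m n : nat) (hmn : (m <= n)%N) (A : 'M[F]_(m, n))
    (eps : R) :
  \rank A = m ->
  (forall (K : 'M[F]_(n, n - m)) (f : 'I_(n - m) -> 'I_n),
    rowsub f K = 1%:M ->
    \sum_(t | degenerate K t) rows_pmf rho t <= eps) ->
  1 - eps <= prob (random_rows F rho01 n (n - m))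
               (fun t => append_rows hmn A t \in unitmx).
Proof.
move=> /kernel_param[K [f [Kf kerA]]] /(_ K f Kf) deg.
rewrite lerBlDr -[X in X <= _](sum_rows_pmf F rho n (n - m)).
rewrite (bigID (fun t => append_rows hmn A t \in unitmx)) /= lerD2l.
apply: le_trans deg.
rewrite big_mkcond [leRHS]big_mkcond; apply: ler_sum => t _.
have nneg : 0 <= rows_pmf rho t by exact: rows_pmf_ge0.
case: ifPn => [/(append_rows_singular kerA)[u u0 tu]|_]; last by case: ifP.
rewrite ifT //; apply/existsP; exists u; rewrite u0 /=.
by apply/forallP => i; rewrite tu.
Qed.

(** For [rho = 1] every [b_w] with [w > 0] is [1/q], so the first moment sum is at most
    [q^(-k) (1 + (q-1))^k = 1] and the probability at most [1/(q-1)]. *)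
Lemma degenerate_dense_le (R : realType) (F : finFieldType) (n k : nat)
    (K : 'M[F]_(n, k)) (f : 'I_k -> 'I_n) :
  (10 <= #|F|)%N -> rowsub f K = 1%:M ->
  \sum_(t | degenerate K t) rows_pmf (1 : R) t <= 9^-1.
Proof.
move=> q10 Kf; have one01 : 0 <= (1 : R) <= 1 by rewrite ler01 lexx.
have := degenerate_moment_bound one01 Kf.
have Q10 : 10 <= #|F|%:R :> R by rewrite (ler_nat _ 10).
set P := \sum_(t | _) _ => /le_trans-/(_ 1) h.
suff : (#|F|%:R - 1) * P <= 1.
  have P0 : 0 <= P by apply: sumr_ge0 => t _; exact: rows_pmf_ge0.
  by move: (#|F|%:R) Q10 => Q; nra.
apply: h.
have Q0 : #|F|%:R != 0 :> R by rewrite gt_eqF //; move: Q10; lra.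
under eq_bigr => w _.
  rewrite /zero_prob subrr expr0n /= mulr0 addr0 [_ * _ ^+ k]mulrC -mulrnAr.
  over.
rewrite -mulr_sumr.
apply: le_trans (ler_wpM2l _ (sum_bin_exp_le k _)) _.
- by rewrite exprn_ge0 // invr_ge0.
- by move: Q10; lra.
by rewrite addrC subrK -exprMn mulVf // expr1n.
Qed.

(** From [1 - a <= e^(-a)]; the hypothesis keeps [1 - a] nonnegative, so that powers are
    monotone. *)
Lemma pow_1B_ln_le (R : realType) (n k c : nat) : (0 < n)%N -> (0 < k)%N ->
  c%:R * ln n%:R <= k%:R :> R ->
  (1 - c%:R * ln n%:R / k%:R) ^+ k <= n%:R^-1 ^+ c :> R.
Proof.
move=> n0 k0 h; have kR : 0 < k%:R :> R by rewrite ltr0n.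
set a := _ / _; have a1 : a <= 1 by rewrite ler_pdivrMr // mul1r.
apply: (@le_trans _ _ (expR (- a) ^+ k)).
  by rewrite lerXn2r ?nnegrE ?expR_ge0 ?subr_ge0 // expR_ge1Dx.
rewrite -expRM_natr mulNr mulfVK ?gt_eqF //.
by rewrite mulrC expRN expRM_natr lnK ?posrE ?ltr0n // exprVn.
Qed.

Lemma degenerate_sparse_le (R : realType) (F : finFieldType) (n k : nat)
    (K : 'M[F]_(n, k)) (f : 'I_k -> 'I_n) (rho : R) :
  (1236 <= k <= n)%N -> (297 <= #|F|)%N -> 0 <= rho <= 1 ->
  (1 - rho) ^+ k <= n%:R^-1 ^+ 6 -> rowsub f K = 1%:M ->
  \sum_(t | degenerate K t) rows_pmf rho t <= 9^-1.
Proof.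
move=> /andP[k_ge k_le] q_ge rho01 xk Kf.
have x01 : 0 <= 1 - rho <= 1 by move: rho01; lra.
have [qn|qn] := leqP #|F| (n ^ 2); last first.
  apply: le_trans (degenerate_guess_bound rho01 Kf) _.
  exact: guess_sum_le k_ge k_le q_ge x01 xk qn.
have Q297 : 297 <= #|F|%:R :> R by rewrite (ler_nat _ 297).
rewrite -(ler_pM2l (_ : 0 < #|F|%:R - 1)); last by move: Q297; lra.
apply: le_trans (degenerate_moment_bound rho01 Kf) _.
exact: moment_sum_le k_ge k_le q_ge x01 xk qn.
Qed.

Lemma upsilon_ge (R : realType) (N k : nat) :
  (18 <= N)%N -> upsilon R N <= k%:Z -> (1236 <= k)%N.
Proof.
move=> hN; rewrite /upsilon ceil_le_int => h.
have N18 : 18 <= N%:R :> R by rewrite (ler_nat _ 18).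
have ln0 : 0 <= ln (2 * N%:R + 1 : R) by rewrite ln_ge0 //; lra.
rewrite -(ltr_nat R) (_ : k%:R = k%:Z%:~R) //.
by apply: lt_le_trans h; nra.
Qed.

Theorem theorem1p2 (R : realType) (N : nat) (hN : (18 <= N)%N)
    (F : finFieldType) (q : nat) (hF : #|F| = q) (hq : (16 * N + 9 <= q)%N)
    (m n : nat) (hmn : (m <= n)%N) (hn : (1 <= n)%N) :
  exists P : distr R ((n - m).-tuple 'rV[F]_n),
    let total := expect P (fun t => (nonzero_entries t)%:R) in
    [/\ (upsilon R N <= (n - m)%N%:Z ->
           total <= sigma R N q * n%:R * ln n%:R + tau R * n%:R),
        (~ upsilon R N <= (n - m)%N%:Z ->
           total <= (q%:R - 1) / q%:R * (n - m)%N%:R * n%:R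
           /\ (q%:R - 1) / q%:R * (n - m)%N%:R * n%:R
              <= (q%:R - 1) / q%:R * (upsilon R N)%:~R * n%:R :> R)
      & forall A : 'M[F]_(m, n), \rank A = m ->
          ((q <= n ^ 2)%N ->
             prob P (fun t => append_rows hmn A t \in unitmx) >= 8 / 9)
          /\ ((q > n ^ 2)%N ->
             prob P (fun t => append_rows hmn A t \in unitmx)
               >= 8 / 9 - 8 / (9 * n%:R))].
Proof.
have q297 : (297 <= #|F|)%N by lia.
have Q0 : 297 <= #|F|%:R :> R by rewrite (ler_nat _ 297).
set k := (n - m)%N; set L := ln n%:R : R.
have L0 : 0 <= L by rewrite ln_ge0 // ler1n.
(* When [k <= 6 ln n], full density already costs at most [6 ln n] per column, up to the factor
   [1 - 1/q]. *)
pose rho : R :=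
  if (upsilon R N <= k%:Z) && (6 * L < k%:R) then 6 * L / k%:R else 1.
have k0R : 0 <= k%:R :> R by [].
have [rho01 [rho_cost deg]] : 0 <= rho <= 1 /\
  ((upsilon R N <= k%:Z -> rho * k%:R <= 6 * L) /\
  forall (K : 'M[F]_(n, k)) f, rowsub f K = 1%:M ->
    \sum_(t | degenerate K t) rows_pmf rho t <= 9^-1).
  rewrite /rho; case: ifP => [/andP[/(upsilon_ge hN) k_ge Lk]|dense].
    have k0 : 0 < k%:R :> R by rewrite ltr0n; lia.
    have r01 : 0 <= 6 * L / k%:R <= 1.
      by rewrite divr_ge0 ?mulr_ge0 //= ler_pdivrMr // mul1r ltW.
    split=> //; split=> [_|K f Kf]; first by rewrite divfK // gt_eqF.
    apply: degenerate_sparse_le Kf => //; first by rewrite k_ge leq_subr.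
    by apply: (@pow_1B_ln_le _ _ _ 6) => //; [lia | exact: ltW].
  rewrite ler01 lexx; split=> //; split=> [ups|K f Kf].
    by move: dense; rewrite ups /= mul1r => /negbT; rewrite -leNgt.
  by apply: degenerate_dense_le Kf; lia.
exists (random_rows F rho01 n k) => total.
have totalE : total = (1 - #|F|%:R^-1) * rho * k%:R * n%:R.
  exact: expect_nonzero_entries.
have Qpos : 0 <= 1 - #|F|%:R^-1 :> R.
  by rewrite subr_ge0 invf_le1; move: Q0; lra.
have QE : (#|F|%:R - 1) / #|F|%:R = 1 - #|F|%:R^-1 :> R.
  by rewrite mulrBl mulfV ?mul1r // gt_eqF //; move: Q0; lra.
rewrite -hF QE; split=> [ups|ups|A rA].
- rewrite totalE /sigma /tau !mul1r.
  apply: (@le_trans _ _ ((1 - #|F|%:R^-1) * (6 * L * n%:R))).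
    by rewrite -!mulrA ler_wpM2l // !mulrA ler_wpM2r // rho_cost.
  rewrite -[leLHS]addr0 lerD // -!mulrA ler_wpM2l //.
  by rewrite [n%:R * _]mulrC [leRHS]mulrDl lerDl !mulr_ge0 ?invr_ge0.
- have kE : rho = 1 by rewrite /rho; case: (upsilon R N <= k%:Z) ups.
  rewrite totalE kE mulr1; split=> //.
  rewrite ler_wpM2r // ler_wpM2l //.
  rewrite (_ : k%:R = k%:Z%:~R) // ler_int.
  by have := le_total k%:Z (upsilon R N) => /orP[].
have := prob_unit_ge rho01 hmn rA deg.
have n0 : 0 <= 8 / (9 * n%:R) :> R by rewrite divr_ge0 // mulr_ge0.
rewrite -/k; set p := prob _ _ => p_ge.
by split=> _; move: n0; lra.
Qed.
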